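(* Let $G=G(n)$ be a sequence of simple graphs with vertex set $\{1,\ldots,n\}$ and maximum degree $\varDelta=\varDelta(n)$, and let $\boldsymbol b=\boldsymbol b(n)=(b_1,\ldots,b_n)$ be the imbalance sequence of some orientation of $G$. Assume that, as $n\to\infty$, $n^{1/3+\varepsilon}\le\varDelta\le n-1$ for some constant $\varepsilon>0$, and $h(G)\ge\gamma\varDelta$ for some constant $\gamma>0$. If $$\|\boldsymbol b\|_\infty=o\Bigl(\varDelta^{3/2}n^{-1/2}\Bigl(\log\tfrac{2n}{\varDelta}\Bigr)^{-1}\Bigr),$$ then there is $R=R(n)\ge 0$ with $$R=O\Bigl(\frac{\|\boldsymbol b\|_\infty}{\varDelta}\log\frac{2n}{\varDelta}\Bigr)$$ such that the following holds: the equations $\sum_{k:jk\in G}\frac{r_j-r_k}{r_j+r_k}=b_j$ ($1\le j\le n$) have a solution $\boldsymbol r=(r_1,\ldots,r_n)$ with positive entries such that $\frac{r_j}{r_k}\le 1+R$ for all $jk\in G$, and moreover $R=O(1)$ and $R^2\,\frac{n}{\varDelta}\log\frac{2n}{\varDelta}=o(\log n)$.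
   Context: An orientation of $G$ assigns one of the two directions to each edge. The imbalance of a vertex is its out-degree minus its in-degree; the imbalance sequence lists these for all vertices. The Cheeger constant is $h(G)=\min\{|\partial_G U|/|U| : U\subset V(G),\ 1\le |U|\le \frac12|V(G)|\}$, where $\partial_G U$ is the set of edges with exactly one end in $U$. The notation $jk\in G$ means that $jk$ is an edge of $G$. Statements are for $n$ sufficiently large; implicit constants may depend on $\varepsilon$ and $\gamma$. *)

(* Defs.v *)
From mathcomp Require Import all_boot all_order all_algebra.
From mathcomp Require Import all_classical all_reals all_analysis.

Set Implicit Arguments.
Unset Strict Implicit.
Unset Printing Implicit Defensive.

Import Order.TTheory GRing.Theory Num.Theory.
Import numFieldNormedType.Exports.

Local Open Scope ring_scope.

Record sgraph (T : finType) := SGraph {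
  adj :> rel T;
  adj_sym : symmetric adj;
  adj_irr : irreflexive adj }.

Section Graph.
Variables (T : finType) (G : sgraph T).

Definition degree (x : T) : nat := #|[set y | G x y]|.

Definition max_degree : nat := \max_(x : T) degree x.

Definition edges : {set {set T}} :=
  [set [set p.1; p.2] | p in [set p : T * T | G p.1 p.2]].

Definition edge_boundary (U : {set T}) : {set {set T}} :=
  [set e in edges | #|e :&: U| == 1%N].

(* An extended-real minimum: the value +oo only arises when there is no
   admissible U, that is, when #|T| < 2. *)
Definition cheeger (R : realType) : \bar R :=
  \big[Order.min/+oo%E]_(U : {set T} | (0 < #|U|)%N && (#|U|.*2 <= #|T|)%N)
    (#|edge_boundary U|%:R / #|U|%:R)%:E.

Definition is_orientation (o : rel T) : Prop :=
  (forall x y, o x y -> G x y) /\ (forall x y, G x y -> o x y (+) o y x).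

Definition imbalance (o : rel T) (x : T) : int :=
  #|[set y | o x y]|%:Z - #|[set y | o y x]|%:Z.

Definition is_imbalance_sequence (b : T -> int) : Prop :=
  exists2 o : rel T, is_orientation o & b =1 imbalance o.

Definition solves_balance (R : realType) (b : T -> int) (r : T -> R) : Prop :=
  forall j, \sum_(k | G j k) (r j - r k) / (r j + r k) = (b j)%:~R.

End Graph.

Definition sup_norm (T : finType) (b : T -> int) : nat :=
  \max_(x : T) `|b x|%N.

(* Main.v *)
Require Import Defs.
From mathcomp Require Import all_boot all_order all_algebra.
From mathcomp Require Import all_classical all_reals all_analysis.
From mathcomp Require Import ring lra.

(* The left-hand side of the balance equation at [j] increases in [r j] and
   decreases in the other [r k], so Perron's method solves the system between
   two constant obstacles [1] and [K], with an inequality wherever an obstacle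
   is touched.  The net flow out of an upper level set [U] is then at most
   [B * |U|], while expansion provides at least [gamma * D * |U|] arcs leaving
   [U]; hence half of these arcs carry flow less than [s = 2B / (gamma * D)],
   so they lose at most a factor [p = 1 - 2s] in [r].  One such step down from
   the maximum reaches [gamma * D / 2] vertices and each further step
   multiplies the size of the level set by [1 + gamma / 2], so that
   [O(log (2n / D))] steps reach more than half of the vertices.  The same from
   the minimum (replace [r] by [1 / r]) bounds [max r / min r].  For [K] larger
   than this bound only one obstacle can be touched, and since both sides of
   the system sum to zero, all inequalities are equalities. *)

Import Order.TTheory GRing.Theory Num.Theory.
Import numFieldNormedType.Exports.

Set Implicit Arguments.
Unset Strict Implicit.
Unset Printing Implicit Defensive.

Local Open Scope ring_scope.

(** * Flow along one edge *)

Section EdgeFlow.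
Variable R : realFieldType.
Implicit Types x y z s d : R.

Definition edge_flow x y : R := (x - y) / (x + y).

Lemma edge_flowC x y : edge_flow y x = - edge_flow x y.
Proof. by rewrite /edge_flow (addrC y x) -mulNr opprB. Qed.

Lemma edge_flow_ge0 x y : 0 < y -> y <= x -> 0 <= edge_flow x y.
Proof.
move=> y0 yx; rewrite divr_ge0 ?subr_ge0// addr_ge0// ltW//.
exact: lt_le_trans yx.
Qed.

Lemma edge_flowV x y : 0 < x -> 0 < y ->
  edge_flow x^-1 y^-1 = - edge_flow x y.
Proof.
move=> x0 y0; rewrite /edge_flow; field.
by rewrite !gt_eqF//= addr_gt0.
Qed.

Lemma edge_flow_antitone x y z : 0 < x -> 0 < y -> y <= z ->
  edge_flow x z <= edge_flow x y.
Proof.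
move=> x0 y0 yz; have z0 := lt_le_trans y0 yz.
rewrite ler_pdivrMr ?addr_gt0// mulrAC ler_pdivlMr ?addr_gt0//.
nra.
Qed.

(** The two flows differ by [2 * y * (x' - x) / ((x' + y) * (x + y))], and the lower bound 1 on all
    values makes the Lipschitz constant 1. *)
Lemma edge_flow_lip x x' y d : 1 <= x -> 1 <= x' -> 1 <= y ->
  0 <= d -> x' <= x + d -> edge_flow x' y <= edge_flow x y + d.
Proof.
move=> x1 x'1 y1 d0 xd.
have -> : edge_flow x' y = edge_flow x y + 2 * y * (x' - x) / ((x' + y) * (x + y)).
  by rewrite /edge_flow; field; rewrite !gt_eqF//; lra.
rewrite lerD2l ler_pdivrMr; last by rewrite mulr_gt0; lra.
have h : 2 * y <= (x' + y) * (x + y) by nra.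
have h1 : 2 * y * (x' - x) <= 2 * y * d by apply: ler_wpM2l; lra.
have h2 : d * (2 * y) <= d * ((x' + y) * (x + y)) by apply: ler_wpM2l.
lra.
Qed.

(** Flow at least [s] means [(1 + s) * y <= (1 - s) * x], and [(1 + s) * (1 - 2 * s) <= 1 - s]. *)
Lemma edge_flow_ge_drop x y s : 0 < x -> 0 < y -> 0 < s ->
  y < (1 - 2 * s) * x -> s <= edge_flow x y.
Proof.
move=> x0 y0 s0 h; rewrite ler_pdivlMr ?addr_gt0//.
have h2 : (1 + s) * y <= (1 + s) * ((1 - 2 * s) * x).
  by apply: ler_wpM2l; lra.
nra.
Qed.

End EdgeFlow.

(** * Net flow, arcs and cuts *)

Section Flow.
Variables (R : realFieldType) (T : finType) (G : sgraph T).
Implicit Types (r : T -> R) (U W : {set T}).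

Definition net_flow r j : R := \sum_(k | G j k) edge_flow (r j) (r k).

(** Ordered pairs turn sums over arcs into double sums over tails and heads; for [W = ~: U] each
    boundary edge appears once, directed out of [U]. *)
Definition arcs U W : {set T * T} :=
  [set p | [&& p.1 \in U, p.2 \in W & G p.1 p.2]].

Lemma arcs_sum U W (F : T -> T -> R) :
  \sum_(p in arcs U W) F p.1 p.2 = \sum_(j in U) \sum_(k in W | G j k) F j k.
Proof.
rewrite (pair_big_dep (mem U) (fun j k => (k \in W) && G j k)) /=.
by apply: eq_bigl => p; rewrite inE.
Qed.

Lemma card_arcs U W :
  #|arcs U W| = (\sum_(k in W) #|[set j in U | G j k]|)%N.
Proof.
rewrite -sum1_card.
transitivity (\sum_(j in U) \sum_(k in W | G j k) 1)%N.
  rewrite (pair_big_dep (mem U) (fun j k => (k \in W) && G j k)) /=.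
  by apply: eq_bigl => p; rewrite inE.
rewrite (exchange_big_dep (mem W)) /=; last by move=> i j _ /andP[].
apply: eq_bigr => k kW; rewrite -sum1_card.
by apply: eq_bigl => j; rewrite inE kW.
Qed.

Lemma card_arcs_le_degree U W : (#|arcs U W| <= max_degree G * #|W|)%N.
Proof.
rewrite card_arcs mulnC -sum_nat_const; apply: leq_sum => k _.
apply: leq_trans (leq_bigmax k); apply: subset_leq_card.
by apply/fintype.subsetP => j; rewrite !inE adj_sym => /andP[].
Qed.

Lemma card_arcs_le_source U W : (#|arcs U W| <= #|U| * #|W|)%N.
Proof.
rewrite card_arcs mulnC -sum_nat_const; apply: leq_sum => k _.
by apply: subset_leq_card; apply/fintype.subsetP => j; rewrite !inE => /andP[].
Qed.

Lemma card_edge_boundary U : (#|edge_boundary G U| <= #|arcs U (~: U)|)%N.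
Proof.
suff: edge_boundary G U \subset [set [set p.1; p.2] | p in arcs U (~: U)].
  by move=> /subset_leq_card/leq_trans; apply; exact: leq_imset_card.
apply/fintype.subsetP => e; rewrite inE => /andP[/imsetP[[x y]]].
rewrite inE/= => xy -> /cards1P[z ez].
have [xU|xU] := boolP (x \in U); have [yU|yU] := boolP (y \in U).
- have : x \in [set z] by rewrite -ez !inE eqxx xU.
  have : y \in [set z] by rewrite -ez !inE eqxx yU orbT.
  by rewrite !inE => /eqP yz /eqP xz; move: xy; rewrite xz yz adj_irr.
- by apply/imsetP; exists (x, y) => //; rewrite !inE /= xU yU.
- apply/imsetP; exists (y, x) => /=; first by rewrite !inE /= xU yU adj_sym.
  by rewrite finset.setUC.
- have : z \in [set x; y] :&: U by rewrite ez inE.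
  by rewrite !inE => /andP[/orP[]/eqP->]; rewrite (negPf xU, negPf yU).
Qed.

(* Flows along the arcs inside [U] cancel in pairs. *)
Lemma net_flow_cut r U :
  \sum_(j in U) net_flow r j =
  \sum_(p in arcs U (~: U)) edge_flow (r p.1) (r p.2).
Proof.
rewrite (arcs_sum _ _ (fun j k => edge_flow (r j) (r k))).
have -> : \sum_(j in U) net_flow r j =
  \sum_(j in U) \sum_(k in U | G j k) edge_flow (r j) (r k) +
  \sum_(j in U) \sum_(k in ~: U | G j k) edge_flow (r j) (r k).
  rewrite -big_split; apply: eq_bigr => j _ /=.
  rewrite /net_flow (bigID (mem U)) /=; congr (_ + _);
    by apply: eq_bigl => k; rewrite ?inE andbC.
suff -> : \sum_(j in U) \sum_(k in U | G j k) edge_flow (r j) (r k) = 0.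
  by rewrite add0r.
set S := LHS; suff : S = - S by move=> h; lra.
rewrite {1}/S (exchange_big_dep (mem U)) /=; last by move=> i j _ /andP[].
rewrite -sumrN; apply: eq_bigr => k kU; rewrite -sumrN; apply: eq_big => j.
  by rewrite kU adj_sym.
by move=> _; rewrite edge_flowC.
Qed.

Lemma sum_net_flow r : \sum_j net_flow r j = 0.
Proof.
rewrite (eq_bigl (mem [set: T])); last by move=> j; rewrite /= inE.
rewrite net_flow_cut big1// => p; rewrite !inE => /andP[]//.
Qed.

Lemma net_flowV r j : (forall k, 0 < r k) ->
  net_flow (fun k => (r k)^-1) j = - net_flow r j.
Proof.
by move=> r0; rewrite -sumrN; apply: eq_bigr => k _; rewrite edge_flowV.
Qed.

(** Raising the other values only lowers the flow out of [j], and raising [r j] by [d] adds at most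
    [d] on each incident edge. *)
Lemma net_flow_lip (r r' : T -> R) j d : 0 <= d ->
  (forall k, 1 <= r k) -> (forall k, 1 <= r' k) ->
  r' j <= r j + d -> (forall k, k != j -> r k <= r' k) ->
  net_flow r' j <= net_flow r j + #|T|%:R * d.
Proof.
move=> d0 r1 r'1 jd kd.
have h : net_flow r' j <= \sum_(k | G j k) (edge_flow (r j) (r k) + d).
  apply: ler_sum => k jk.
  apply: (le_trans (y := edge_flow (r j) (r' k) + d)).
    by apply: edge_flow_lip.
  rewrite lerD2r; apply: edge_flow_antitone; rewrite ?(lt_le_trans ltr01)//.
  by apply: kd; apply: contraTneq jk => ->; rewrite adj_irr.
apply: le_trans h _; rewrite big_split lerD2l /=.
rewrite sumr_const -[leLHS]mulr_natl ler_wpM2r// ler_nat.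
exact: max_card.
Qed.

End Flow.

(** * Perron's method between two obstacles *)

(* The solution is the pointwise supremum of the subsolutions [S]. *)
Lemma obstacle_problem (R : realType) (T : finType) (G : sgraph T)
    (b : T -> R) (K : R) : 1 <= K ->
  exists r : T -> R,
    [/\ forall j, 1 <= r j <= K,
        forall j, 1 < r j -> net_flow G r j <= b j
      & forall j, r j < K -> b j <= net_flow G r j].
Proof.
move=> K1.
pose S (u : T -> R) := (forall j, 1 <= u j <= K) /\
  (forall j, 1 < u j -> net_flow G u j <= b j).
have S1 : S (fun=> 1) by split=> j; rewrite ?lexx// ltxx.
pose E j : set R := [set u j | u in S]%classic.
have supE j : has_sup (E j).
  split; first by exists 1, (fun=> 1).
  by exists K => _ [u [uK _] <-]; case/andP: (uK j).
pose r j := sup (E j).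
have le_r u j : S u -> u j <= r j.
  by move=> Su; apply: sup_upper_bound => //; exists u.
have r1 j : 1 <= r j by exact: (le_r (fun=> 1)).
have rK j : r j <= K.
  apply: ge_sup; first by case: (supE j).
  by move=> _ [u [uK _] <-]; case/andP: (uK j).
have n0 : 0 < #|T|.+1%:R :> R by rewrite ltr0n.
have n1 : #|T|%:R <= #|T|.+1%:R :> R by rewrite ler_nat.
have r_sub j : 1 < r j -> net_flow G r j <= b j.
  move=> rj1; rewrite leNgt; apply/negP => bj.
  (* Take a subsolution within [d] of the supremum at [j]. The first bound keeps it above 1 there;
     the second, as [#|T|.+1] beats the Lipschitz constant [#|T|], makes it violate its own
     inequality. *)
  pose d := Num.min (r j - 1) ((net_flow G r j - b j) / #|T|.+1%:R).
  have d0 : 0 < d by rewrite lt_min subr_gt0 rj1 divr_gt0// subr_gt0.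
  have d1 : d <= r j - 1 by rewrite ge_min lexx.
  have d2 : #|T|.+1%:R * d <= net_flow G r j - b j.
    by rewrite mulrC -ler_pdivlMr// ge_min lexx orbT.
  have [_ [u Su <-] ud] := sup_adherent d0 (supE j).
  have {ud}ud : r j - d < u j by [].
  have [uK ub] := Su.
  have h : net_flow G r j <= net_flow G u j + #|T|%:R * d.
    apply: net_flow_lip => //; first exact: ltW.
    - by move=> k; case/andP: (uK k).
    - by rewrite -lerBlDr ltW.
    - by move=> k _; apply: le_r.
  have uj : net_flow G u j <= b j by apply: ub; lra.
  by move: d2; rewrite -natr1 mulrDl; lra.
exists r; split=> [j|//|j rjK]; first by rewrite r1 rK.
rewrite leNgt; apply/negP => bj.
pose d := Num.min (K - r j) ((b j - net_flow G r j) / #|T|.+1%:R).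
have d0 : 0 < d by rewrite lt_min subr_gt0 rjK divr_gt0// subr_gt0.
have d1 : d <= K - r j by rewrite ge_min lexx.
have d2 : #|T|.+1%:R * d <= b j - net_flow G r j.
  by rewrite mulrC -ler_pdivlMr// ge_min lexx orbT.
(* Raising [r] at [j] alone keeps it a subsolution, since the flows out of the other vertices can
   only drop; this contradicts the supremum. *)
pose u k := if k == j then r j + d else r k.
have uj : u j = r j + d by rewrite /u eqxx.
have u_neq k : k != j -> u k = r k by rewrite /u => /negPf->.
have le_u k : r k <= u k.
  by have [->|/u_neq->//] := eqVneq k j; rewrite uj lerDl ltW.
have u1 k : 1 <= u k by exact: le_trans (le_u k).
suff /(le_r u j) : S u by rewrite uj; lra.
split=> k.
  rewrite u1 /=; have [->|/u_neq->//] := eqVneq k j.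
  by rewrite uj; lra.
have [->|kj] := eqVneq k j => uk1.
  have h : net_flow G u j <= net_flow G r j + #|T|%:R * d.
    by apply: net_flow_lip; rewrite ?uj// ltW.
  by move: d2; rewrite -natr1 mulrDl; lra.
have h : net_flow G u k <= net_flow G r k + #|T|%:R * 0.
  by apply: net_flow_lip; rewrite ?u_neq ?addr0.
rewrite mulr0 addr0 in h; apply: le_trans h _.
by apply: r_sub; rewrite -(u_neq k).
Qed.

(** * Growth of level sets by expansion *)

Section Expansion.
Variables (R : realFieldType) (T : finType) (G : sgraph T).
Variables (gamma s : R).
Hypotheses (gamma_gt0 : 0 < gamma) (s_gt0 : 0 < s) (s_lt : 2 * s < 1).
Let D : R := (max_degree G)%:R.
Let p : R := 1 - 2 * s.
Hypothesis D_gt0 : 0 < D.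
Hypothesis expansion : forall U : {set T}, (0 < #|U|)%N ->
  (#|U|.*2 <= #|T|)%N -> gamma * D * #|U|%:R <= #|arcs G U (~: U)|%:R.

Let p_gt0 : 0 < p. Proof. by rewrite subr_gt0. Qed.
Let p_le1 : p <= 1. Proof. by rewrite gerBl mulr_ge0// ltW. Qed.

Section UpperLevels.
(** Stated for a general obstacle [a] so as to apply twice: to the function between the obstacles
    with [a = 1], and to its reciprocal with [a = K^-1] and [- b]. *)
Variables (r b : T -> R) (a : R).
Hypotheses (r_gt0 : forall j, 0 < r j) (a_ge0 : 0 <= a).
Hypothesis b_le : forall j, 2 * b j <= s * (gamma * D).
Hypothesis flow_le : forall j, a < r j -> net_flow G r j <= b j.

Let level t : {set T} := [set k | t <= r k].

(* At least half of the arcs leaving [U] carry a flow less than [s], and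
   those end above height [p * t]. *)
Lemma many_short_arcs (U : {set T}) t : (0 < #|U|)%N ->
  (#|U|.*2 <= #|T|)%N -> a < t -> (forall j, j \in U -> t <= r j) ->
  (forall k, k \notin U -> r k <= t) ->
  gamma * D / 2 * #|U|%:R <= #|arcs G U (level (p * t) :\: U)|%:R.
Proof.
move=> U0 U2 at_ Ut Ut'.
have t0 : 0 < t by exact: le_lt_trans at_.
pose A := arcs G U (~: U); pose W := level (p * t).
have AP e : e \in A -> [/\ t <= r e.1, r e.2 <= t & G e.1 e.2].
  by rewrite inE => /and3P[/Ut ? +]; rewrite inE => /Ut' ? ?.
have flowU : \sum_(e in A) edge_flow (r e.1) (r e.2)
    <= s * (gamma * D) / 2 * #|U|%:R.
  rewrite -net_flow_cut mulr_natr -sumr_const; apply: ler_sum => j jU.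
  have jt := Ut _ jU; have := flow_le (lt_le_trans at_ jt).
  by have := b_le j; lra.
(* An arc ending outside [W] drops by more than the factor [p] and so carries at least [s]; all
   other arcs of the cut go downhill and carry nonnegative flow. *)
have flowW : s * \sum_(e in A | e.2 \notin W) 1
    <= \sum_(e in A) edge_flow (r e.1) (r e.2).
  rewrite [leRHS](bigID (fun e => e.2 \in W)) /= mulr_sumr.
  rewrite -[leLHS]add0r lerD//.
    apply: sumr_ge0 => e /andP[/AP[h1 h2 _] _]; apply: edge_flow_ge0 => //.
    exact: le_trans h1.
  apply: ler_sum => e /andP[/AP[h1 h2 _]]; rewrite inE -ltNge => h.
  rewrite mulr1; apply: edge_flow_ge_drop => //; apply: lt_le_trans h _.
  by rewrite -/p ler_pM2l.
have cardA : #|A|%:R = #|arcs G U (W :\: U)|%:R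
    + \sum_(e in A | e.2 \notin W) 1 :> R.
  rewrite -[X in X%:R]sum1_card natr_sum (bigID (fun e => e.2 \in W)) /=.
  congr (_ + _); rewrite -sum1_card natr_sum; apply: eq_bigl => e.
  by rewrite !inE andbAC; case: (_ \in U); case: (_ \in U); rewrite ?andbF.
have := expansion U0 U2; rewrite -/A cardA.
have : s * \sum_(e in A | e.2 \notin W) 1 <= s * (gamma * D / 2 * #|U|%:R).
  apply: le_trans (flowW) _; apply: le_trans flowU _.
  by rewrite le_eqVlt; apply/orP; left; apply/eqP; field.
rewrite ler_pM2l//; lra.
Qed.

(** The first two alternatives persist as the level is lowered. While neither holds, the level set
    is small enough to expand and lies above the obstacle, so [many_short_arcs] applies. *)
Lemma level_growth v i : (1 < #|T|)%N -> (forall k, r k <= r v) ->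
  [\/ r v * p ^+ i.+1 <= a,
      (#|T| < #|level (r v * p ^+ i.+1)%R|.*2)%N
    | gamma * D / 2 * (1 + gamma / 2) ^+ i
        <= #|level (r v * p ^+ i.+1)|%:R].
Proof.
move=> T1 vmax; elim: i => [|i IH].
  have [va|av] := leP (r v) a.
    apply: Or31; rewrite expr1; apply: le_trans va.
    by rewrite ler_piMr// ltW.
  apply: Or33; rewrite expr0 mulr1 expr1.
  (* Arcs out of a single vertex have distinct heads, so the first step reaches order [D] vertices
     at once; this is why the step count involves [2n / D] rather than [n]. *)
  have h : gamma * D / 2 * #|[set v]|%:R
      <= #|arcs G [set v] (level (p * r v) :\: [set v])|%:R.
    apply: many_short_arcs => //; rewrite ?cards1// => j.
    by rewrite inE => /eqP->.
  rewrite cards1 mulr1 in h; apply: le_trans h _; rewrite ler_nat.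
  apply: leq_trans (card_arcs_le_source _ _ _) _; rewrite cards1 mul1n.
  by rewrite mulrC subset_leq_card// subsetDl.
set t := r v * p ^+ i.+1 in IH *.
have t0 : 0 < t by rewrite mulr_gt0// exprn_gt0.
have -> : r v * p ^+ i.+2 = p * t by rewrite exprSr mulrA mulrC.
have pt : p * t <= t by rewrite ler_piMl// ltW.
have sub_level : level t \subset level (p * t).
  by apply/fintype.subsetP => k; rewrite !inE; apply: le_trans.
case: IH => [ta|half|IH].
- by apply: Or31; exact: le_trans ta.
- apply: Or32; apply: leq_trans half _.
  by rewrite leq_double subset_leq_card.
have [ta|at_] := leP t a; first by apply: Or31; exact: le_trans ta.
have [half|half] := ltnP #|T| #|level t|.*2.
  apply: Or32; apply: leq_trans half _.
  by rewrite leq_double subset_leq_card.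
apply: Or33.
have h : gamma * D / 2 * #|level t|%:R
    <= #|arcs G (level t) (level (p * t) :\: level t)|%:R.
  apply: many_short_arcs => // [|j|k]; last 2 first.
  - by rewrite inE.
  - by rewrite inE -ltNge => /ltW.
  apply/card_gt0P; exists v; rewrite inE /t ler_piMr//; first exact: ltW.
  by rewrite exprn_ile1// ltW.
(* Each new vertex is the head of at most [D] arcs, so the factor [D] cancels. *)
have /(le_trans h) {}h :
    #|arcs G (level t) (level (p * t) :\: level t)|%:R
      <= D * #|level (p * t) :\: level t|%:R.
  by rewrite -natrM ler_nat card_arcs_le_degree.
have {h} : gamma / 2 * #|level t|%:R <= #|level (p * t) :\: level t|%:R.
  by rewrite -(ler_pM2l D_gt0); apply: le_trans h; rewrite le_eqVlt;
    apply/orP; left; apply/eqP; ring.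
rewrite cardsD (finset.setIidPr sub_level) natrB ?subset_leq_card// => h.
rewrite exprSr mulrA.
have : gamma * D / 2 * (1 + gamma / 2) ^+ i * (1 + gamma / 2)
    <= #|level t|%:R * (1 + gamma / 2).
  by rewrite ler_pM2r// addr_gt0// divr_gt0.
lra.
Qed.

Lemma level_majority v N : (1 < #|T|)%N -> (forall k, r k <= r v) ->
  #|T|%:R < gamma * D * (1 + gamma / 2) ^+ N ->
  r v * p ^+ N.+1 <= a \/
  (#|T| < #|[set k | (r v * p ^+ N.+1 <= r k)%R]|.*2)%N.
Proof.
move=> T1 vmax hN; case: (level_growth N T1 vmax) => [|h|h]; [by left|by right|].
right; rewrite -(ltr_nat R) -muln2 natrM; apply: lt_le_trans hN _.
by move: h; rewrite /level; lra.
Qed.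

End UpperLevels.

(** If neither descent meets its obstacle, the two majorities share a vertex [u], and
    [r v * q <= r u], [r u * q <= r w]. Otherwise [r v * q <= 1 <= r w] or
    [r v * q <= K * q <= r w]. The bound does not involve [K]. *)
Lemma obstacle_ratio (r b : T -> R) K N : (1 < #|T|)%N -> 1 <= K ->
  (forall j, 1 <= r j <= K) ->
  (forall j, 1 < r j -> net_flow G r j <= b j) ->
  (forall j, r j < K -> b j <= net_flow G r j) ->
  (forall j, 2 * `|b j| <= s * (gamma * D)) ->
  #|T|%:R < gamma * D * (1 + gamma / 2) ^+ N ->
  forall v w, r v * (p ^+ N.+1 * p ^+ N.+1) <= r w.
Proof.
move=> T1 K1 rK r_sub r_sup bs hN.
have r1 j : 1 <= r j by case/andP: (rK j).
have leK j : r j <= K by case/andP: (rK j).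
have r0 j : 0 < r j by exact: lt_le_trans (r1 j).
have K0 : 0 < K by exact: lt_le_trans K1.
have /card_gt0P[x0 _] : (0 < #|T|)%N by exact: ltnW.
have [v _ vmax] := @arg_maxP _ _ _ x0 predT r isT.
have [w _ wmin] := @arg_minP _ _ _ x0 predT r isT.
set q := p ^+ N.+1.
have q0 : 0 < q by rewrite exprn_gt0.
have q1 : q <= 1 by rewrite exprn_ile1// ltW.
suff vw : r v * (q * q) <= r w.
  move=> v' w'; apply: le_trans (wmin w' isT); apply: le_trans vw.
  by rewrite ler_pM2r ?mulr_gt0//; apply: vmax.
have b_le j : 2 * b j <= s * (gamma * D).
  by apply: le_trans (bs j); rewrite ler_pM2l// ler_norm.
have nb_le j : 2 * - b j <= s * (gamma * D).
  by apply: le_trans (bs j); rewrite ler_pM2l// -normrN ler_norm.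
pose r' j := (r j)^-1.
have r'0 j : 0 < r' j by rewrite invr_gt0.
have r'_sub j : K^-1 < r' j -> net_flow G r' j <= - b j.
  by rewrite ltf_pV2 ?posrE// [net_flow _ _ _](net_flowV G j r0) lerN2; exact: r_sup.
have K'0 : 0 <= K^-1 by rewrite invr_ge0 ltW.
have r'max k : r' k <= r' w by rewrite lef_pV2 ?posrE//; exact: wmin.
have inv_le x y : 0 < x -> 0 < y -> x^-1 * q <= y^-1 -> y * q <= x.
  by move=> x0_ y0; rewrite mulrC -ler_pdivlMr ?invr_gt0// invrK
    -[leRHS]mulrC ler_pdivlMr// mulrC.
have [h|h] := level_majority r0 ler01 b_le r_sub T1 (fun k => vmax k isT) hN.
  rewrite mulrA; apply: le_trans (r1 w); apply: le_trans h.
  by rewrite ler_piMr// mulr_ge0// ltW.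
have [h'|h'] := level_majority r'0 K'0 nb_le r'_sub T1 r'max hN.
  have {}h' := inv_le _ _ (r0 w) K0 h'.
  rewrite mulrA; apply: le_trans h'; rewrite ler_pM2r//.
  by apply: le_trans (leK v); rewrite ler_piMr// ltW.
set A := [set k | _] in h; set B := [set k | _] in h'.
have /card_gt0P[u] : (0 < #|A :&: B|)%N.
  rewrite -(ltn_add2l #|A :|: B|) cardsUI addn0.
  apply: leq_ltn_trans (max_card _) _.
  by rewrite -ltn_double doubleD -addnn -addSn; apply: leq_add => //; exact: ltnW.
rewrite !inE => /andP[uA /(inv_le _ _ (r0 w) (r0 u))].
by apply: le_trans; rewrite mulrA ler_pM2r.
Qed.

End Expansion.

(** * Input from the orientation and the Cheeger constant; the number of steps *)

(** Every arc of the orientation counts once at its tail and once at its head. *)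
Lemma sum_imbalance (T : finType) (G : sgraph T) (b : T -> int) :
  is_imbalance_sequence G b -> \sum_j b j = 0.
Proof.
case=> o _ bo; rewrite (eq_bigr _ (fun j _ => bo j)) /imbalance sumrB.
have card_sum (P : pred T) : #|[set y | P y]|%:Z = \sum_(y | P y) 1.
  by rewrite -[LHS]natz -sum1_card natr_sum; apply: eq_bigl => y; rewrite inE.
apply/eqP; rewrite subr_eq0; apply/eqP.
under eq_bigr do rewrite card_sum.
under [RHS]eq_bigr do rewrite card_sum.
by rewrite (exchange_big_dep predT).
Qed.

Lemma cheeger_expansion (R : realType) (T : finType) (G : sgraph T) (g : R)
    (U : {set T}) : (g%:E <= cheeger G R)%E -> (0 < #|U|)%N ->
  (#|U|.*2 <= #|T|)%N -> g * #|U|%:R <= #|arcs G U (~: U)|%:R.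
Proof.
move=> /bigmin_geP[_ /(_ U) h] U0 U2.
move: h; rewrite U0 U2 => /(_ isT).
rewrite lee_fin ler_pdivlMr ?ltr0n// => /le_trans; apply.
by rewrite ler_nat card_edge_boundary.
Qed.

(** Bernoulli's inequality. *)
Lemma le_1B_natmul_exp (R : realFieldType) (x : R) n :
  0 <= x -> x <= 1 -> 1 - n%:R * x <= (1 - x) ^+ n.
Proof.
move=> x0 x1; elim: n => [|n IH]; first by rewrite mul0r subr0.
have h : (1 - n%:R * x) * (1 - x) <= (1 - x) ^+ n * (1 - x).
  by rewrite ler_wpM2r// subr_ge0.
have n0 : 0 <= n%:R * x * x by rewrite !mulr_ge0.
by rewrite exprSr -natr1; lra.
Qed.

Lemma growth_steps (R : realType) (gamma : R) : 0 < gamma ->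
  exists2 A : R, 0 < A & forall y, 2 <= y ->
  exists2 N, y <= gamma * (1 + gamma / 2) ^+ N & N.+1%:R <= A * ln y.
Proof.
move=> g0.
have ln2 : 0 < ln (2 : R) by rewrite ln_gt0// ltr1n.
set c : R := 1 + gamma / 2.
have c1 : 1 < c by rewrite /c; lra.
have k0 : 0 < ln c by rewrite ln_gt0.
(* Chosen so that [A' * ln y * ln c >= ln y + gamma^-1]; then [expR gamma^-1 >= gamma^-1] absorbs
   the factor [gamma]. *)
pose A' := (1 + gamma^-1 / ln 2) / ln c.
have A'0 : 0 < A' by rewrite divr_gt0// addr_gt0// divr_gt0// invr_gt0.
(* The extra term pays for [N.+1 = m + 2] exceeding [m] by 2, because [ln y >= ln 2]. *)
exists (A' + 2 / ln 2); first by rewrite addr_gt0// divr_gt0.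
move=> y y2; have y0 : 0 < y by lra.
have lny : ln 2 <= ln y by rewrite ler_ln ?posrE//; lra.
have lny0 : 0 < ln y by exact: lt_le_trans lny.
pose m := Num.truncn (A' * ln y); exists m.+1.
  have h : ln y + gamma^-1 <= m.+1%:R * ln c.
    apply: (@le_trans _ _ (A' * ln y * ln c)).
      have -> : A' * ln y * ln c = ln y + gamma^-1 * (ln y / ln 2).
        by rewrite /A'; field; rewrite !gt_eqF.
      rewrite lerD2l ler_peMr ?invr_ge0 ?(ltW g0)//.
      by rewrite ler_pdivlMr// mul1r.
    by rewrite ler_wpM2r// ?(ltW k0)//; exact/ltW/truncnS_gt.
  have -> : c ^+ m.+1 = expR (m.+1%:R * ln c).
    by rewrite expRM_natl lnK// posrE; lra.
  rewrite -ler_pdivrMl//.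
  have : expR (ln y + gamma^-1) <= expR (m.+1%:R * ln c) by rewrite ler_expR.
  apply: le_trans; rewrite expRD lnK ?posrE// mulrC ler_pM2l//.
  by have := expR_ge1Dx gamma^-1; lra.
have h : m%:R <= A' * ln y by rewrite truncn_le mulr_ge0// ltW.
have h2 : 2 <= 2 / ln 2 * ln y.
  by rewrite mulrAC ler_pdivlMr// ler_pM2l.
by rewrite -addn2 natrD; lra.
Qed.

Lemma eq_of_le_sum (R : numDomainType) (T : finType) (f g : T -> R) :
  (forall i, f i <= g i) -> \sum_i f i = \sum_i g i -> f =1 g.
Proof.
move=> fg eq_fg i; apply/eqP; rewrite eq_sym -subr_eq0; apply/eqP.
apply: (psumr_eq0P (P := predT) (F := fun i => g i - f i)) => //.
  by move=> j _; rewrite subr_ge0.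
by rewrite sumrB eq_fg subrr.
Qed.

(** * Solving the balance equations with a ratio bound *)

Lemma balance_solution (R : realType) (T : finType) (G : sgraph T)
    (b : T -> int) (gamma s : R) (N : nat) :
  0 < gamma -> 0 < s -> 2 * s < 1 -> (1 < #|T|)%N -> (0 < max_degree G)%N ->
  is_imbalance_sequence G b ->
  ((gamma * (max_degree G)%:R)%:E <= cheeger G R)%E ->
  2 * (sup_norm b)%:R <= s * (gamma * (max_degree G)%:R) ->
  #|T|%:R < gamma * (max_degree G)%:R * (1 + gamma / 2) ^+ N ->
  exists r : T -> R,
    [/\ forall j, 0 < r j, solves_balance G b r
      & forall j k, r j * (1 - 2 * s) ^+ (N.+1 + N.+1) <= r k].
Proof.
move=> g0 s0 s1 T1 D0 bb hG bs hN.
set q := (1 - 2 * s) ^+ (N.+1 + N.+1).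
have q0 : 0 < q by rewrite exprn_gt0// subr_gt0.
(* Ratios are at most [q^-1 < K], so if some value equals 1, all values stay strictly below [K]. *)
pose K := q^-1 + 1.
have K1 : 1 <= K by rewrite lerDr invr_ge0 ltW.
pose c j : R := (b j)%:~R.
have [r [rK r_sub r_sup]] := obstacle_problem G c K1.
have cs j : 2 * `|c j| <= s * (gamma * (max_degree G)%:R).
  apply: le_trans bs; rewrite ler_pM2l// /c -intr_norm -abszE -pmulrn ler_nat.
  exact: leq_bigmax.
have D0R : 0 < (max_degree G)%:R :> R by rewrite ltr0n.
have ratio := @obstacle_ratio R T G gamma s g0 s0 s1 D0R
  (fun U => @cheeger_expansion R T G _ U hG) r c K N T1 K1 rK r_sub r_sup cs hN.
have r1 j : 1 <= r j by case/andP: (rK j).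
have {}ratio j k : r j * q <= r k by rewrite /q exprD; exact: ratio.
exists r; split=> [j||//]; first exact: lt_le_trans (r1 j).
have sumc : \sum_j c j = \sum_j net_flow G r j.
  by rewrite sum_net_flow -rmorph_sum (sum_imbalance bb).
suff h : forall j, net_flow G r j = c j by [].
have [[w rw] j|min_gt1] := pselect (exists w, r w = 1).
  apply/esym; move: j; apply: eq_of_le_sum => // j; apply: r_sup.
  have := ratio j w; rewrite rw -ler_pdivlMr// mul1r /K => h.
  by apply: le_lt_trans h _; rewrite ltrDl.
apply: eq_of_le_sum => // j; apply: r_sub; rewrite lt_neqAle r1 andbT.
by apply/eqP => rj; apply: min_gt1; exists j.
Qed.

Lemma balance_solution_small (R : realType) (gamma : R) : 0 < gamma ->
  exists2 A : R, 0 < A & forall (T : finType) (G : sgraph T) (b : T -> int),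
  let D : R := (max_degree G)%:R in
  let x := A * ((sup_norm b)%:R / D * ln (2 * #|T|%:R / D)) in
  (1 < #|T|)%N -> (0 < max_degree G <= #|T|)%N ->
  is_imbalance_sequence G b -> ((gamma * D)%:E <= cheeger G R)%E ->
  x <= 2^-1 ->
  exists r : T -> R,
    [/\ forall j, 0 < r j, solves_balance G b r
      & forall j k, r j / r k <= 1 + 2 * x].
Proof.
move=> g0; have [A0 A0_gt0 steps] := growth_steps g0.
(* This makes [x = 4 * s * (A0 * L)] for the threshold [s = 2B / (gamma * D)], and the total loss
   over [2 * N.+1] steps of ratio [1 - 2 * s] is at most [4 * s * N.+1 <= x]. *)
exists (8 * A0 / gamma); first by rewrite divr_gt0// mulr_gt0.
move=> T G b D x T1 /andP[D0 DT] bb hG x_le.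
have D0R : 0 < D by rewrite ltr0n.
have DTR : D <= #|T|%:R by rewrite ler_nat.
have y2 : 2 <= 2 * #|T|%:R / D by rewrite ler_pdivlMr// ler_pM2l.
have [N hN NA] := steps _ y2.
set L := ln _ in x x_le NA *.
have L0 : 0 < L by rewrite ln_gt0//; lra.
(* Zero imbalance would give [s = 0]; the constant function solves this case. *)
have [B0|B0] := posnP (sup_norm b).
  have b0 j : b j = 0.
    by apply/eqP; rewrite -absz_eq0 -leqn0 -B0; exact: leq_bigmax.
  exists (fun=> 1); split=> // [j|j k].
    by rewrite big1 ?b0// => k _; rewrite subrr mul0r.
  by rewrite divr1 lerDl /x B0 mul0r mul0r !mulr0.
set B : R := (sup_norm b)%:R in x x_le *.
have B0R : 0 < B by rewrite ltr0n.
pose s := 2 * B / (gamma * D).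
have s0 : 0 < s by rewrite divr_gt0// mulr_gt0.
have NN : 4 * s * N.+1%:R <= x.
  have -> : x = 4 * s * (A0 * L).
    by rewrite /x /s; field; rewrite !gt_eqF.
  by rewrite ler_pM2l// mulr_gt0.
have N1 : 4 * s <= 4 * s * N.+1%:R by rewrite ler_peMr ?ler1n// mulr_ge0// ltW.
have s1 : 2 * s < 1 by lra.
have [||r [r0 r_sol ratio]] := balance_solution (N := N) g0 s0 s1 T1 D0 bb hG.
- by rewrite -/B -/D /s divfK// gt_eqF// mulr_gt0.
- have n0 : 0 < #|T|%:R :> R by rewrite ltr0n ltnW.
  rewrite -/D mulrAC -ltr_pdivrMr//.
  apply: lt_le_trans hN; rewrite -mulrA ltr_pMl ?divr_gt0// ltr1n//.
exists r; split=> // j k; rewrite ler_pdivrMr//.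
have := ratio j k; have h2s : 0 <= 2 * s by rewrite mulr_ge0// ltW.
have := le_1B_natmul_exp (N.+1 + N.+1) h2s (ltW s1); rewrite natrD => h1 h2.
have h3 : r j * (1 - x) <= r k.
  apply: le_trans h2; rewrite ler_pM2l//; apply: le_trans h1; lra.
have x0 : 0 <= x by apply: le_trans NN; rewrite mulr_ge0// mulr_ge0// ltW.
(* For [0 <= x <= 1/2] one has [(1 + 2 * x) * (1 - x) >= 1]. *)
have h4 : (1 + 2 * x) * (r j * (1 - x)) <= (1 + 2 * x) * r k.
  by apply: ler_wpM2l => //; lra.
apply: le_trans h4; rewrite mulrCA ler_peMr ?(ltW (r0 j))//.
nra.
Qed.

(** * Asymptotics *)

Lemma max_degree_le (n : nat) (G : sgraph 'I_n) : (max_degree G <= n)%N.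
Proof.
apply/bigmax_leqP => j _; rewrite -[leqRHS]card_ord; exact: max_card.
Qed.

Lemma sqr_powR_scale (R : realType) (x y : R) : 0 < x -> 0 < y ->
  (x `^ (3 / 2) * y `^ (- 2^-1)) ^+ 2 = x ^+ 3 / y.
Proof.
move=> x0 y0; rewrite exprMn -!powR_mulrn ?powR_ge0// -?powRrM ?ltW//.
rewrite mulfVK ?pnatr_eq0// mulNr mulVf ?pnatr_eq0//.
by rewrite powRN powRr1 ?ltW.
Qed.

(** With [u = D^(3/2) n^(-1/2)] one has [B * L <= e * u] and [u^2 = D^3 / n <= D^2], which gives
    both bounds after dividing by [D]. *)
Lemma ratio_bounds (R : realType) (n D B L e : R) : 2 <= n -> 1 <= D ->
  D <= n -> 0 <= B -> 0 < L -> 0 <= e ->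
  B <= e * (D `^ (3 / 2) * n `^ (- 2^-1) * L^-1) ->
  B / D * L <= e /\ (B / D * L) ^+ 2 * (n / D) * L <= e ^+ 2 * L.
Proof.
move=> n2 D1 Dn B0 L0 e0.
have n0 : 0 < n by lra.
have D0 : 0 < D by lra.
set u := _ `^ _ * _ => h.
have u0 : 0 <= u by rewrite mulr_ge0// powR_ge0.
have u2 : u ^+ 2 = D ^+ 3 / n by exact: sqr_powR_scale.
have BL : B * L <= e * u by rewrite -ler_pdivlMr// -mulrA.
have uD : u <= D.
  rewrite -(@ler_pXn2r _ 2) ?nnegrE ?(ltW D0)// u2 ler_pdivrMr// exprSr.
  by rewrite ler_pM2l// exprn_gt0.
have -> : B / D * L = B * L / D by rewrite mulrAC.
split; first by rewrite ler_pdivrMr//; apply: le_trans BL _; rewrite ler_wpM2l.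
rewrite ler_pM2r//.
have -> : e ^+ 2 = (e * u) ^+ 2 / D ^+ 2 * (n / D).
  by rewrite exprMn u2; field; rewrite !gt_eqF.
rewrite ler_pM2r ?divr_gt0// expr_div_n ler_pM2r ?invr_gt0 ?exprn_gt0//.
by rewrite ler_pXn2r// nnegrE mulr_ge0// ltW.
Qed.

Lemma ln_ratio_le (R : realType) (n D : R) : 2 <= n -> 1 <= D -> D <= n ->
  ln (2 * n / D) <= 2 * ln n.
Proof.
move=> n2 D1 Dn; have n0 : 0 < n by lra.
have -> : 2 * ln n = ln (n * n) by rewrite lnM// mulr2n mulrDl mul1r.
rewrite ler_ln ?posrE ?divr_gt0 ?mulr_gt0//; last by lra.
rewrite ler_pdivrMr; last by lra.
nra.
Qed.

Local Open Scope classical_set_scope.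
Local Open Scope ring_scope.

Theorem theorem4 (R : realType) (eps gamma : R)
    (eps_gt0 : 0 < eps) (gamma_gt0 : 0 < gamma) :
  exists2 C : R, 0 < C &
  forall (G : forall n, sgraph 'I_n) (b : forall n, 'I_n -> int),
  let D n : R := (max_degree (G n))%:R in
  let B n : R := (sup_norm (b n))%:R in
  let L n : R := ln (2 * n%:R / D n) in
  (forall n, is_imbalance_sequence (G n) (b n)) ->
  (\forall n \near \oo, n%:R `^ (3^-1 + eps) <= D n <= n%:R - 1) ->
  (\forall n \near \oo, ((gamma * D n)%:E <= cheeger (G n) R)%E) ->
  B =o_\oo (fun n => D n `^ (3 / 2) * n%:R `^ (- 2^-1) * (L n)^-1) ->
  exists rho : nat -> R,
    [/\ forall n, 0 <= rho n,
        \forall n \near \oo, rho n <= C * (B n / D n * L n),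
        \forall n \near \oo, exists r : 'I_n -> R,
          [/\ forall j, 0 < r j,
              solves_balance (G n) (b n) r
            & forall j k, G n j k -> r j / r k <= 1 + rho n],
        \forall n \near \oo, rho n <= C
      & (fun n => rho n ^+ 2 * (n%:R / D n) * L n) =o_\oo
          (fun n => ln n%:R)].
Proof.
have [A A0 sol] := balance_solution_small gamma_gt0.
(* The term [2 * A] serves the bound by [B n / D n * L n]; the added 1 serves [rho n <= C], as
   eventually [rho n <= 1/2]. *)
exists (2 * A + 1); first by rewrite addr_gt0// mulr_gt0.
move=> G b D B L b_imb D_bounds hG B_small.
pose y n := B n / D n * L n.
(* The absolute value gives nonnegativity for every [n]; it disappears for large [n]. *)
exists (fun n => 2 * A * `|y n|).
have D_range : \forall n \near \oo, [/\ 2 <= n%:R :> R, 1 <= D n & D n <= n%:R].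
  near=> n.
  have n_gt0 : (0 < n)%N by near: n; exact: nbhs_infty_gt.
  have /andP[Dl Du] : n%:R `^ (3^-1 + eps) <= D n <= n%:R - 1 by near: n.
  have D1 : 1 <= D n.
    rewrite /D ler1n -(ltr0n R); apply: lt_le_trans Dl.
    by rewrite powR_gt0// ltr0n.
  by split; lra.
have L_gt0 n : 2 <= n%:R :> R -> 1 <= D n -> D n <= n%:R -> 0 < L n.
  by move=> n2 D1 Dn; rewrite ln_gt0// ltr_pdivlMr; lra.
have y_ge0 : \forall n \near \oo, 0 <= y n.
  near=> n; have [n2 D1 Dn] : [/\ 2 <= n%:R :> R, 1 <= D n & D n <= n%:R].
    by near: n.
  by rewrite mulr_ge0 ?divr_ge0 ?ler0n// ltW// L_gt0.
have y_small e : 0 < e -> \forall n \near \oo,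
    y n <= e /\ y n ^+ 2 * (n%:R / D n) * L n <= e ^+ 2 * L n.
  move=> e0; move/eqoP : B_small => /(_ e e0) B_small.
  near=> n; have [n2 D1 Dn] : [/\ 2 <= n%:R :> R, 1 <= D n & D n <= n%:R].
    by near: n.
  apply: ratio_bounds; rewrite ?ler0n ?L_gt0 ?(ltW e0)//.
  have : `|B n| <= e * `|D n `^ (3 / 2) * n%:R `^ (- 2^-1) * (L n)^-1| by near: n.
  rewrite !ger0_norm ?ler0n//.
  by rewrite !mulr_ge0 ?powR_ge0// invr_ge0 ltW// L_gt0.
(* Below this threshold [A * y n <= 1/4], within the range of [balance_solution_small]. *)
have half_gt0 : 0 < (2 * A)^-1 / 2 by rewrite divr_gt0// invr_gt0 mulr_gt0.
split.
- by move=> n; rewrite !mulr_ge0// ltW.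
- near=> n; have yn : 0 <= y n by near: n.
  by rewrite ger0_norm// ler_wpM2r// lerDl.
- near=> n; have [n2 D1 Dn] : [/\ 2 <= n%:R :> R, 1 <= D n & D n <= n%:R].
    by near: n.
  have yn : 0 <= y n by near: n.
  have [] := sol 'I_n (G n) (b n); rewrite ?card_ord.
  + by rewrite -(ler_nat R).
  + by rewrite max_degree_le andbT -(ler_nat R).
  + exact: b_imb.
  + by near: n.
  + rewrite -/(B n) -/(D n) -/(L n) -/(y n) mulrC -ler_pdivlMr// mulrC.
    have [+ _] : y n <= (2 * A)^-1 / 2 /\
      y n ^+ 2 * (n%:R / D n) * L n <= ((2 * A)^-1 / 2) ^+ 2 * L n.
      by near: n; exact: y_small.
    move/le_trans; apply; rewrite invfM -mulrA mulrC ler_pM2l ?invr_gt0//; lra.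
  move=> r [r0 r_sol ratio]; exists r; split=> // j k _.
  by rewrite ger0_norm// -mulrA; exact: ratio.
- near=> n; have yn : 0 <= y n by near: n.
  have [h _] : y n <= (2 * A)^-1 / 2 /\
    y n ^+ 2 * (n%:R / D n) * L n <= ((2 * A)^-1 / 2) ^+ 2 * L n.
    by near: n; exact: y_small.
  rewrite ger0_norm//; have : 2 * A * y n <= 2 * A * ((2 * A)^-1 / 2).
    by rewrite ler_pM2l// mulr_gt0.
  by rewrite mulVKf ?gt_eqF ?mulr_gt0//; lra.
- apply/eqoP => e e0.
  (* Solves [(2 * A)^2 * d * 2 = e], where the 2 comes from [L n <= 2 * ln n]; [y_small] is used
     with the square root of [d]. *)
  pose d := e / (2 * (2 * A) ^+ 2).
  have A2 : 0 < 2 * (2 * A) ^+ 2 by rewrite mulr_gt0// exprn_gt0// mulr_gt0.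
  have d0 : 0 < d by rewrite divr_gt0.
  near=> n; have [n2 D1 Dn] : [/\ 2 <= n%:R :> R, 1 <= D n & D n <= n%:R].
    by near: n.
  have yn : 0 <= y n by near: n.
  have Ln := L_gt0 n n2 D1 Dn.
  have [_ h] : y n <= Num.sqrt d /\
    y n ^+ 2 * (n%:R / D n) * L n <= Num.sqrt d ^+ 2 * L n.
    by near: n; apply: y_small; rewrite sqrtr_gt0.
  rewrite (sqr_sqrtr (ltW d0)) in h.
  have ln_n : 0 <= ln (n%:R : R) by rewrite ln_ge0//; lra.
  rewrite (ger0_norm yn) (ger0_norm ln_n) ger0_norm; last first.
    by rewrite (mulr_ge0 _ (ltW Ln))// (mulr_ge0 (sqr_ge0 _))// divr_ge0 ?ler0n.
  have h2 := ln_ratio_le n2 D1 Dn; rewrite -/(L n) in h2.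
  have h3 : (2 * A) ^+ 2 * (y n ^+ 2 * (n%:R / D n) * L n)
      <= (2 * A) ^+ 2 * (d * (2 * ln n%:R)).
    by apply: ler_wpM2l; [exact: sqr_ge0 | apply: le_trans h _; rewrite ler_pM2l].
  rewrite exprMn -!mulrA; rewrite -!mulrA in h3; apply: le_trans h3 _.
  by rewrite le_eqVlt; apply/orP; left; apply/eqP; rewrite /d; field; rewrite gt_eqF.
Unshelve. all: by end_near. Qed.
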